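(* Let $A$ and $D$ be sets and let $\mathsf{R}(D,A)$ be the relational lattice on $D$ and $A$. Then for all $x,y,z,z_0,z_1,z_2 \in \mathsf{R}(D,A)$ the following three inequalities hold: \begin{align*} &(\mathrm{SymPC})\quad x \wedge (y \vee z) \leq \bigl(x \wedge (y \vee (z \wedge (x \vee y)))\bigr) \vee \bigl(x \wedge (z \vee (y \wedge (x \vee z)))\bigr),\\ &(\mathrm{VarRL1})\quad x \wedge \bigl((y \wedge z) \vee (y \wedge x) \vee (z \wedge x)\bigr) \leq (x \wedge y) \vee (x \wedge z),\\ &(\mathrm{RMod})\quad x \wedge \bigl((x \wedge y) \vee (z_0 \wedge (z_1 \vee z_2))\bigr) \leq \Bigl(x \wedge \bigl((x \wedge y) \vee (z_0\wedge z_1) \vee (z_0 \wedge z_2)\bigr)\Bigr) \vee \bigl(x \wedge z_0 \wedge (z_1 \vee z_2)\bigr). \end{align*}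
   Context: For sets $A$ (attribute names) and $D$ (values), the relational lattice $\mathsf{R}(D,A)$ has as elements the pairs $(X,T)$ with $X \subseteq A$ and $T \subseteq D^X$ (a set of functions $X \to D$). The order is $(X_1,T_1) \leq (X_2,T_2)$ iff $X_2 \subseteq X_1$ and $\{f|_{X_2} : f \in T_1\} \subseteq T_2$. With this order it is a lattice: the meet is the natural join $(X_1,T_1)\wedge(X_2,T_2) = (X_1 \cup X_2, \{f \in D^{X_1\cup X_2} : f|_{X_1} \in T_1,\ f|_{X_2} \in T_2\})$ and the join is the inner union $(X_1,T_1)\vee(X_2,T_2) = (X_1\cap X_2, \{f|_{X_1\cap X_2} : f \in T_1\} \cup \{f|_{X_1 \cap X_2} : f \in T_2\})$. *)

(* Defs.v *)
From HB Require Import structures.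
From mathcomp Require Import all_boot all_order.
From mathcomp Require Import boolp classical_sets.

Set Implicit Arguments.
Unset Strict Implicit.
Unset Printing Implicit Defensive.

Local Open Scope classical_set_scope.

(* The elements [(X, T)] of R(D, A): a subset [X] of [A] and a subset [T] of
   [D ^ X], where [X -> D] is the type of functions on the subtype of [X]. *)
Record rlat (D A : Type) := RLat {
  header : set A;
  body : set (header -> D) }.

Arguments body {D A} r _ : rename.

Fact rlat_display : Order.disp_t. Proof. exact: (Order.Disp tt tt). Qed.

Section RelationalLattice.
Variables D A : Type.
Implicit Types (X Y Z : set A) (r s t : rlat D A).

HB.instance Definition _ := gen_eqMixin (rlat D A).
HB.instance Definition _ := gen_choiceMixin (rlat D A).

Definition sub_incl X Y (YX : Y `<=` X) (a : Y) : X :=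
  exist _ (val a) (mem_set (YX (val a) (set_mem (valP a)))).

Definition restr X Y (YX : Y `<=` X) (f : X -> D) : Y -> D :=
  fun a => f (sub_incl YX a).

Lemma restr_id X (XX : X `<=` X) (f : X -> D) : restr XX f = f.
Proof. by apply/funext => a; congr f; apply: val_inj. Qed.

Lemma restr_comp X Y Z (YX : Y `<=` X) (ZY : Z `<=` Y) (ZX : Z `<=` X)
  (f : X -> D) : restr ZY (restr YX f) = restr ZX f.
Proof. by apply/funext => a; congr f; apply: val_inj. Qed.

Definition rle r s : Prop :=
  exists sr : header s `<=` header r, restr sr @` body r `<=` body s.

Definition natural_join r s : rlat D A :=
  @RLat D A (header r `|` header s)
    [set f | body r (restr (@subsetUl _ (header r) (header s)) f) /\
             body s (restr (@subsetUr _ (header r) (header s)) f)].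

Definition inner_union r s : rlat D A :=
  @RLat D A (header r `&` header s)
    (restr (@subIsetl _ (header r) (header s)) @` body r `|`
     restr (@subIsetr _ (header r) (header s)) @` body s).

Lemma rle_refl : reflexive (fun r s => `[< rle r s >]).
Proof.
by move=> r; apply/asboolP; exists (fun=> id) => _ [f rf <-]; rewrite restr_id.
Qed.

Lemma rle_anti : antisymmetric (fun r s => `[< rle r s >]).
Proof.
move=> [X R] [Y S] /andP[/asboolP[/= YX RS] /asboolP[/= XY SR]].
have eqXY : X = Y by apply/seteqP.
case: Y / eqXY S YX RS XY SR => S YX RS XY SR.
congr RLat; apply/seteqP; split=> f Pf.
  by apply: RS; exists f; rewrite ?restr_id.
by apply: SR; exists f; rewrite ?restr_id.
Qed.

Lemma rle_trans : transitive (fun r s => `[< rle r s >]).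
Proof.
move=> s r t /asboolP[sr rs] /asboolP[ts st].
apply/asboolP; exists (subset_trans ts sr) => _ [f rf <-].
by rewrite -(restr_comp sr ts); apply: st; eexists; first by apply: rs; exists f.
Qed.

HB.instance Definition _ := Order.Le_isPOrder.Build rlat_display
  (rlat D A) rle_refl rle_anti rle_trans.

Lemma natural_joinP r s t :
  (r <= natural_join s t)%O = (r <= s)%O && (r <= t)%O.
Proof.
apply/asboolP/andP => [[/= str H]|[/asboolP[sr rs] /asboolP[tr rt]]].
  split; apply/asboolP.
    exists (subset_trans (@subsetUl _ _ _) str) => _ [f rf <-].
    by rewrite -(restr_comp str (@subsetUl _ _ _));
      have [] := H _ (ex_intro2 _ _ f rf erefl).
  exists (subset_trans (@subsetUr _ _ _) str) => _ [f rf <-].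
  by rewrite -(restr_comp str (@subsetUr _ _ _));
    have [] := H _ (ex_intro2 _ _ f rf erefl).
have str : header (natural_join s t) `<=` header r by rewrite /= subUset.
exists str => _ [f rf <-] /=; split.
  by rewrite (restr_comp _ _ sr); apply: rs; exists f.
by rewrite (restr_comp _ _ tr); apply: rt; exists f.
Qed.

Lemma inner_unionP r s t :
  (inner_union r s <= t)%O = (r <= t)%O && (s <= t)%O.
Proof.
apply/asboolP/andP => [[/= trs H]|[/asboolP[tr rt] /asboolP[ts st]]].
  split; apply/asboolP.
    exists (subset_trans trs (@subIsetl _ _ _)) => _ [f rf <-].
    rewrite -(restr_comp (@subIsetl _ _ _) trs); apply: H; eexists; last by [].
    by left; exists f.
  exists (subset_trans trs (@subIsetr _ _ _)) => _ [f sf <-].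
  rewrite -(restr_comp (@subIsetr _ _ _) trs); apply: H; eexists; last by [].
  by right; exists f.
have trs : header t `<=` header (inner_union r s) by rewrite /= subsetI.
exists trs => _ [_ [] [f Pf <-] <-] /=.
  by rewrite (restr_comp _ _ tr); apply: rt; exists f.
by rewrite (restr_comp _ _ ts); apply: st; exists f.
Qed.

HB.instance Definition _ := Order.POrder_MeetJoin_isLattice.Build
  rlat_display (rlat D A) natural_joinP inner_unionP.

Lemma rlat_leE r s : (r <= s)%O = `[< rle r s >].
Proof. by []. Qed.

Lemma rlat_meetE r s : (r `&` s)%O = natural_join r s.
Proof. by []. Qed.

Lemma rlat_joinE r s : (r `|` s)%O = inner_union r s.
Proof. by []. Qed.

End RelationalLattice.

(* Main.v *)
Require Import Defs.
From mathcomp Require Import all_boot all_order.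
From mathcomp Require Import boolp classical_sets.

(** A relation [(X, T)] is determined by [X] and the set of all global rows
    [t] whose restriction to [X] lies in [T]. In these terms a meet intersects
    sets of rows, and a join saturates a union of sets of rows under agreement
    on the common header. Each inequality then holds on headers because it
    holds in every distributive lattice, and on rows by overwriting the witness
    of a join on the left-hand side with the given row on a suitable set of
    attributes. *)

Section GlobalRows.
Import Order.LTheory.
Variables D A : Type.
Implicit Types (X : set A) (r s x y z : rlat D A) (t u : A -> option D).

Definition agree X t u := forall a, X a -> t a = u a.

(* Rows take values in [option D], so that every tuple extends to a global row
   even if [D] is empty. *)
Definition sat r t := exists2 f, body r f & forall a, t (val a) = Some (f a).

Definition overwrite X t u : A -> option D :=
  fun a => if `[< X a >] then t a else u a.

Lemma agree_sym X t u : agree X t u -> agree X u t.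
Proof. by move=> tu a /tu. Qed.

Lemma agree_overwritel X t u : agree X (overwrite X t u) t.
Proof. by move=> a Xa; rewrite /overwrite asboolT. Qed.

Lemma agree_overwriter X Y t u :
  agree (X `&` Y)%classic t u -> agree Y (overwrite X t u) u.
Proof.
by move=> tu a Ya; rewrite /overwrite; case: asboolP => // Xa; apply: tu.
Qed.

Lemma sat_agree r t u : agree (header r) t u -> sat r t -> sat r u.
Proof.
by move=> tu [f rf tf]; exists f => // a; rewrite -tu //; apply: set_mem (valP a).
Qed.

Lemma sat_extension r (f : header r -> D) :
  body r f -> exists2 t, sat r t & forall a, t (val a) = Some (f a).
Proof.
move=> rf.
have tf a : omap f (insub (val a)) = Some (f a) by rewrite valK.
by exists (fun a => omap f (insub a)) => //; exists f.
Qed.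

Lemma sat_restr r X (Xr : (X `<=` header r)%classic) (f : header r -> D) t :
  (forall a, t (val a) = Some (f a)) ->
  forall a : X, t (val a) = Some (restr Xr f a).
Proof. by move=> tf a; rewrite -tf. Qed.

(** If [body r] is empty, no row reveals [header r], so the inclusion of headers is a separate
    hypothesis. *)
Lemma rlat_leP r s :
  (header s `<=` header r)%classic -> (forall t, sat r t -> sat s t) ->
  (r <= s)%O.
Proof.
move=> sr rs; rewrite rlat_leE; apply/asboolP; exists sr => _ [f rf <-].
have [t rt tf] := sat_extension _ _ rf.
have [g sg tg] := rs _ rt; suff -> : restr sr f = g by [].
apply/funext => a; apply: Some_inj.
by rewrite -(sat_restr _ _ sr _ _ tf) tg.
Qed.

Lemma sat_le r s t : (r <= s)%O -> sat r t -> sat s t.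
Proof.
rewrite rlat_leE => /asboolP[sr rs] [f rf tf]; exists (restr sr f).
  by apply: rs; exists f.
exact: sat_restr.
Qed.

Lemma sat_meet r s t : sat (r `&` s)%O t <-> sat r t /\ sat s t.
Proof.
split=> [rst|[[f rf tf] [g sg tg]]].
  by split; apply: sat_le rst; rewrite ?leIl ?leIr.
(* Each attribute of the union lies in one of the two headers, so [t] is defined there and the
   joined tuple is read off from [t]. *)
have t_some (a : (header r `|` header s)%classic) :
    {d | t (val a) = Some d}.
  apply: cid; case: (set_mem (valP a)) => /mem_set ha.
    by exists (f (SigSub ha)); rewrite -tf.
  by exists (g (SigSub ha)); rewrite -tg.
exists (fun a => sval (t_some a)); last by move=> a; case: (t_some a).
split; [suff -> : restr (@subsetUl _ _ _) (fun a => sval (t_some a)) = f by []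
       |suff -> : restr (@subsetUr _ _ _) (fun a => sval (t_some a)) = g by []];
  apply/funext => a; apply: Some_inj; rewrite -?tf -?tg /restr;
  by case: (t_some _).
Qed.

Lemma sat_join r s t :
  sat (r `|` s)%O t <->
  exists2 u, agree (header r `&` header s)%classic t u & sat r u \/ sat s u.
Proof.
split=> [[g rsg tg]|[u tu rsu]]; last first.
  apply: (sat_agree (r `|` s)%O u); first exact: agree_sym.
  by case: rsu; apply: sat_le; rewrite ?leUl ?leUr.
case: rsg tg => -[f Pf <-] tf; have [u su uf] := sat_extension _ _ Pf;
  (exists u; last by tauto); move=> a ha; have := tf (SigSub (mem_set ha)).
  by rewrite -(sat_restr _ _ (@subIsetl _ _ _) _ _ uf).
by rewrite -(sat_restr _ _ (@subIsetr _ _ _) _ _ uf).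
Qed.

Local Open Scope order_scope.

(** Serves both cases of SymPC, the second after exchanging [y] and [z]. *)
Lemma sat_meet_join_sym x y z t u :
  sat x t -> agree (header y `&` header z)%classic t u -> sat y u ->
  sat (x `&` (z `|` (y `&` (x `|` z)))) t.
Proof.
move=> xt tu yu; apply/sat_meet; split=> //; apply/sat_join.
(* Being [u] on [header y] puts [v] in [y]; being [t] on the common header of [x] and [z] puts it in
   the join of [x] and [z], with witness [t]. *)
pose v := overwrite (header x `&` header z)%classic t u.
have vu : agree (header y) v u.
  by apply: agree_overwriter => a [[_ za] ya]; apply: tu.
exists v.
  move=> a [za [ya|xza]]; first by rewrite vu //; apply: tu.
  by rewrite [RHS]agree_overwritel.
right; apply/sat_meet; split; first exact: sat_agree (agree_sym _ _ _ vu) yu.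
by apply/sat_join; exists t; [exact: agree_overwritel | left].
Qed.

Lemma rlat_SymPC x y z :
  x `&` (y `|` z) <=
    (x `&` (y `|` (z `&` (x `|` y)))) `|` (x `&` (z `|` (y `&` (x `|` z)))).
Proof.
apply: rlat_leP => [a /=|t /sat_meet[xt /sat_join[u tu yzu]]]; first tauto.
apply/sat_join; exists t => //; case: yzu => [yu|zu].
  by right; apply: sat_meet_join_sym yu.
by left; apply: sat_meet_join_sym zu => //; rewrite setIC.
Qed.

Lemma sat_meet_overwrite x y t u :
  sat x t -> sat y u -> agree (header x `&` header y)%classic t u ->
  sat (x `&` y) (overwrite (header x) t u).
Proof.
move=> xt yu tu; apply/sat_meet; split.
  exact: sat_agree (agree_sym _ _ _ (agree_overwritel _ _ _)) xt.
exact: sat_agree (agree_sym _ _ _ (agree_overwriter _ _ _ _ tu)) yu.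
Qed.

Lemma rlat_VarRL1 x y z :
  x `&` ((y `&` z) `|` (y `&` x) `|` (z `&` x)) <= (x `&` y) `|` (x `&` z).
Proof.
apply: rlat_leP => [a /=|t /sat_meet[xt xyz]]; first tauto.
(* By distributivity, the header of the triple join is the union of the pairwise intersections of
   the three headers. *)
have [u tu yzu] : exists2 u,
    agree [set a | header x a /\ header y a \/ header x a /\ header z a \/
                   header y a /\ header z a]%classic t u & sat y u \/ sat z u.
  case/sat_join: xyz => u tu [/sat_join[v uv yzv]|/sat_meet[zu _]].
    exists v; first by move=> a /= ?; rewrite tu ?uv //=; tauto.
    by case: yzv => /sat_meet[]; left.
  by exists u; [move=> a /= ?; apply: tu => /=; tauto | right].
(* The common header is now the union of [header x], where the new row is [t], and the overlap of
   [header y] and [header z], where [u] already agrees with [t]. *)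
apply/sat_join; exists (overwrite (header x) t u).
  by move=> a /= ?; rewrite /overwrite; case: asboolP => // ?; apply: tu => /=; tauto.
by case: yzu => [yu|zu]; [left|right];
  apply: sat_meet_overwrite => // a /= ?; apply: tu => /=; tauto.
Qed.

Lemma rlat_RMod x y z0 z1 z2 :
  x `&` ((x `&` y) `|` (z0 `&` (z1 `|` z2))) <=
    (x `&` ((x `&` y) `|` (z0 `&` z1) `|` (z0 `&` z2)))
      `|` (x `&` z0 `&` (z1 `|` z2)).
Proof.
apply: rlat_leP => [a /=|t /sat_meet[xt /sat_join[u tu]]]; first tauto.
case=> [xyu|zu]; apply/sat_join.
  (* Distributing [z0] does not change the header of the join, so [u] remains a witness. *)
  exists t => //; left; apply/sat_meet; split=> //; apply/sat_join.
  exists u; first by move=> a /= ?; apply: tu => /=; tauto.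
  by left; apply: sat_le xyu; apply: leUl.
(* On [header x] this row is [t]; elsewhere it is [u], which agrees with [t] on the common header of
   the original join. *)
exists (overwrite (header x) t u).
  by move=> a /= ?; rewrite /overwrite; case: asboolP => // ?; apply: tu => /=; tauto.
right; rewrite -meetA; apply: sat_meet_overwrite => // a /= ?.
by apply: tu => /=; tauto.
Qed.

End GlobalRows.

Local Open Scope order_scope.

Theorem theorem7 (D A : Type) (x y z z0 z1 z2 : rlat D A) :
  [/\ (* SymPC *)
      x `&` (y `|` z) <=
        (x `&` (y `|` (z `&` (x `|` y)))) `|` (x `&` (z `|` (y `&` (x `|` z)))),
      (* VarRL1 *)
      x `&` ((y `&` z) `|` (y `&` x) `|` (z `&` x)) <=
        (x `&` y) `|` (x `&` z)
    & (* RMod *)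
      x `&` ((x `&` y) `|` (z0 `&` (z1 `|` z2))) <=
        (x `&` ((x `&` y) `|` (z0 `&` z1) `|` (z0 `&` z2)))
          `|` (x `&` z0 `&` (z1 `|` z2)) ].
Proof. split; [exact: rlat_SymPC|exact: rlat_VarRL1|exact: rlat_RMod]. Qed.
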